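(* Let $K\subset\mathbb{R}^n$ be a body, and let $\mathcal{E},\mathcal{F}\subset\mathbb{R}^n$ be ellipsoids. Then $$\mathcal{F}\in\bar{u}_K(\mathcal{E})\quad\Longleftrightarrow\quad u_{K_{\mathcal{F}}^{\circ}}(\mathcal{E})=\mathcal{F}.$$
   Context: A body in $\mathbb{R}^n$ is a compact convex set $K$ with $K=-K$ and non-empty interior; $\|x\|_K=\inf\{\lambda>0: x\in\lambda K\}$ is the norm with unit ball $K$. An ellipsoid means a centrally-symmetric (centered at the origin), non-degenerate ellipsoid. For an ellipsoid $\mathcal{E}$, $\langle\cdot,\cdot\rangle_{\mathcal{E}}$ is the unique scalar product on $\mathbb{R}^n$ with $\mathcal{E}=\{x:\langle x,x\rangle_{\mathcal{E}}\le 1\}$, and $\mu_{\mathcal{E}}$ is the unique Borel probability measure on $\partial\mathcal{E}$ invariant under all linear isometries of $(\mathbb{R}^n,\langle\cdot,\cdot\rangle_{\mathcal{E}})$. For a body $K$, $M_{\mathcal{E}}(K)=\left(\int_{\partial\mathcal{E}}\|x\|_K^2\,d\mu_{\mathcal{E}}(x)\right)^{1/2}$. For a body $K$ and an ellipsoid $\mathcal{E}$: - $u_K(\mathcal{E})$ denotes the unique ellipsoid contained in $K$ at which the infimum $J_K(\mathcal{E})=\inf\{M_{\mathcal{E}}(\mathcal{F}):\mathcal{F}\subset K\text{ an ellipsoid}\}$ is attained (such an ellipsoid exists and is unique); - $K_{\mathcal{E}}^{\circ}=\{x\in\mathbb{R}^n:\forall y\in K,\ \langle x,y\rangle_{\mathcal{E}}\le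 1\}$ is the polar body of $K$ with respect to $\mathcal{E}$; - $I_K(\mathcal{E})=\sup\{M_{\mathcal{E}}(\mathcal{F}):\mathcal{F}\supset K\text{ an ellipsoid}\}$, and $\bar{u}_K(\mathcal{E})$ is the (possibly empty) set of all ellipsoids $\mathcal{F}\subset\mathbb{R}^n$ with $K\subset\mathcal{F}$ and $M_{\mathcal{E}}(\mathcal{F})=I_K(\mathcal{E})$. *)

(* Defs.v *)
From mathcomp Require Import all_boot all_order all_algebra.
From mathcomp Require Import all_classical all_reals all_analysis.

Set Implicit Arguments.
Unset Strict Implicit.
Unset Printing Implicit Defensive.

Import Order.TTheory GRing.Theory Num.Theory.
Import numFieldNormedType.Exports.

Local Open Scope classical_set_scope.
Local Open Scope ring_scope.

(* R^n with its Borel sigma-algebra. *)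
Notation borel_rV R n := (g_sigma_algebraType (@open 'rV[R]_n)).

Section Ellipsoids.
Context {R : realType} {n : nat}.

Local Notation V := 'rV[R]_n.

Definition body (K : set V) : Prop :=
  [/\ compact K, convex_set K, K = [set - x | x in K] & K^° !=set0].

(* The Minkowski functional ||x||_K. *)
Definition gauge_norm (K : set V) (x : V) : R :=
  inf [set lambda | 0 < lambda /\ [set lambda *: y | y in K] x].

Definition euclidean_ball : set V := [set x | \sum_(i < n) x 0 i ^+ 2 <= 1].

(* Centered at the origin and non-degenerate. *)
Definition ellipsoid (E : set V) : Prop :=
  exists2 A : 'M[R]_n, A \in unitmx & E = [set x *m A | x in euclidean_ball].

Definition scalar_product (B : V -> V -> R) : Prop :=
  exists f : {dot V for idfun}, B = f.

(* <.,.>_E; when E is an ellipsoid the set below is a singleton. *)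
Definition dotE (E : set V) : V -> V -> R :=
  get [set B | scalar_product B /\ E = [set x | B x x <= 1]].

Definition boundary (E : set V) : set V := closure E `\` E^°.

(* mu_E, seen as a Borel probability measure on R^n carried by the boundary
   of E. *)
Definition invariant_probability (E : set V)
    (mu : probability (borel_rV R n) R) : Prop :=
  mu (boundary E) = 1%E /\
  forall tau : {linear V -> V},
    (forall x y, dotE E (tau x) (tau y) = dotE E x y) ->
    forall A : set (borel_rV R n), measurable A -> mu (tau @^-1` A) = mu A.

(* In what follows mu stands for mu_E. *)
Definition M_ (mu : probability (borel_rV R n) R) (E K : set V) : R :=
  Num.sqrt (\int[mu]_(x in boundary E) gauge_norm K x ^+ 2).

Definition J_ (mu : probability (borel_rV R n) R) (K E : set V) : R :=
  inf [set M_ mu E F | F in [set F | ellipsoid F /\ F `<=` K]].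

(* When K is a body there is exactly one ellipsoid in the set below, and it is
   the value of u_; the default value of get is set0, not an ellipsoid. *)
Definition u_ (mu : probability (borel_rV R n) R) (K E : set V) : set V :=
  get [set F | [/\ ellipsoid F, F `<=` K & M_ mu E F = J_ mu K E]].

Definition polar (K E : set V) : set V :=
  [set x | forall y, K y -> dotE E x y <= 1].

Definition I_ (mu : probability (borel_rV R n) R) (K E : set V) : R :=
  sup [set M_ mu E F | F in [set F | ellipsoid F /\ K `<=` F]].

Definition ubar (mu : probability (borel_rV R n) R) (K E : set V) :
    set (set V) :=
  [set F | [/\ ellipsoid F, K `<=` F & M_ mu E F = I_ mu K E]].

End Ellipsoids.

(* Main.v *)
(** Write F = B A, with B the Euclidean ball. Since K lies in an ellipsoid G
    if and only if the F-polar of G lies in that of K, and the squared mean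
    M_E(B C)^2 is the value at C^-1 C^-T of a positive definite linear form
    X |-> tr (S X), the two sides of the equivalence compare the quadratic form
    Q_F with the forms Q_G and with the forms Q_G' of their F-polars G'.
    - If F is a maximum, then Q_G + Q_G' - 2 Q_F is the square
      |x (C^-1 - D)|^2, so tr (S Q_G') <= tr (S Q_F) gives
      tr (S Q_G) >= tr (S Q_F), with equality only for G = F.
    - If F is a minimum and G contains K, one moves from F along the convex
      segment joining Q_F to Q_G and differentiates the minimality at t = 0.
    Invariance of mu_E only serves to see that S is nondegenerate: a hyperplane
    of full measure could be reflected onto each coordinate hyperplane. *)

Require Import Defs.
From HB Require Import structures.
From mathcomp Require Import all_boot all_order all_algebra.
From mathcomp Require Import all_classical all_reals all_analysis.
From mathcomp Require Import ring lra.
Import numFieldNormedType.Exports.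

Set Implicit Arguments.
Unset Strict Implicit.
Unset Printing Implicit Defensive.

Import Order.TTheory GRing.Theory Num.Theory.

Local Open Scope classical_set_scope.
Local Open Scope ring_scope.

(** * Euclidean geometry of row vectors *)

Section DotProduct.
Context {R : realType} {n : nat}.
Implicit Types (u v w : 'rV[R]_n) (A : 'M[R]_n) (a : R).

Definition dotr u v : R := (u *m v^T) 0 0.

Lemma dotrE u v : dotr u v = \sum_i u 0 i * v 0 i.
Proof. by rewrite /dotr mxE; apply: eq_bigr => i _; rewrite mxE. Qed.

Lemma dotrC u v : dotr u v = dotr v u.
Proof. by rewrite !dotrE; apply: eq_bigr => i _; rewrite mulrC. Qed.

Lemma dotrDl u v w : dotr (u + v) w = dotr u w + dotr v w.
Proof. by rewrite /dotr mulmxDl mxE. Qed.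

Lemma dotrZl a u v : dotr (a *: u) v = a * dotr u v.
Proof. by rewrite /dotr -scalemxAl mxE. Qed.

Lemma dotrDr u v w : dotr w (u + v) = dotr w u + dotr w v.
Proof. by rewrite dotrC dotrDl !(dotrC w). Qed.

Lemma dotrZr a u v : dotr u (a *: v) = a * dotr u v.
Proof. by rewrite dotrC dotrZl dotrC. Qed.

Lemma dotrBl u v w : dotr (u - v) w = dotr u w - dotr v w.
Proof. by rewrite dotrDl -scaleN1r dotrZl mulN1r. Qed.

Lemma dotrBr u v w : dotr w (u - v) = dotr w u - dotr w v.
Proof. by rewrite dotrC dotrBl !(dotrC w). Qed.

Lemma dotr0l u : dotr 0 u = 0.
Proof. by rewrite /dotr mul0mx mxE. Qed.

Lemma dotr_adj u v A : dotr (u *m A) v = dotr u (v *m A^T).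
Proof. by rewrite /dotr trmx_mul trmxK mulmxA. Qed.

Lemma dotr_sqr u : dotr u u = \sum_i u 0 i ^+ 2.
Proof. by rewrite dotrE; apply: eq_bigr => i _; rewrite expr2. Qed.

Lemma dotr_ge0 u : 0 <= dotr u u.
Proof. by rewrite dotr_sqr sumr_ge0 // => i _; rewrite sqr_ge0. Qed.

Lemma dotr_eq0 u : (dotr u u == 0) = (u == 0).
Proof.
apply/eqP/eqP => [|->]; last by rewrite dotr0l.
rewrite dotr_sqr => /psumr_eq0P h; apply/rowP => i; rewrite mxE.
by apply/eqP; rewrite -sqrf_eq0 h// => j _; rewrite sqr_ge0.
Qed.

Lemma dotr_delta u i : dotr u (delta_mx 0 i) = u 0 i.
Proof. by rewrite /dotr trmx_delta -colE mxE. Qed.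

Lemma dotr_cauchy u v : dotr u v ^+ 2 <= dotr u u * dotr v v.
Proof.
have [->|v0] := eqVneq v 0; first by rewrite dotrC !dotr0l expr0n mulr0.
have vv : 0 < dotr v v by rewrite lt_neqAle eq_sym dotr_eq0 v0 dotr_ge0.
have := dotr_ge0 (dotr v v *: u - dotr u v *: v).
rewrite !(dotrBl, dotrBr, dotrZl, dotrZr) (dotrC v u).
set x := dotr v v in vv *; set y := dotr u v; set z := dotr u u => h.
suff : 0 <= x * (z * x - y ^+ 2) by rewrite pmulr_rge0// subr_ge0.
by apply: le_trans h _; rewrite le_eqVlt; apply/orP; left; apply/eqP; ring.
Qed.

(** Cauchy-Schwarz applied to each column of [A]; the constant is the squared Frobenius norm. *)
Lemma dotr_mulmx_le u A :
  dotr (u *m A) (u *m A) <= (\sum_j \sum_i A i j ^+ 2) * dotr u u.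
Proof.
rewrite [leLHS]dotr_sqr mulr_suml; apply: ler_sum => j _.
have -> : (u *m A) 0 j = dotr u (col j A)^T.
  by rewrite dotrE mxE; apply: eq_bigr => i _; rewrite !mxE.
rewrite mulrC; apply: le_trans (dotr_cauchy _ _) _.
rewrite ler_wpM2l ?dotr_ge0// dotr_sqr le_eqVlt; apply/orP; left; apply/eqP.
by apply: eq_bigr => i _; rewrite !mxE.
Qed.

(** Self-polarity of the Euclidean ball. If |u| > 1, the vector u / |u| violates the constraint;
    conversely, expand |u - v|^2 >= 0. *)
Lemma dotr_le1P u :
  (forall v, dotr v v <= 1 -> dotr u v <= 1) <-> dotr u u <= 1.
Proof.
split=> [h|uu v vv]; last first.
  have := dotr_ge0 (u - v); rewrite !(dotrBl, dotrBr) (dotrC v u); lra.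
rewrite leNgt; apply/negP => u1.
have u0 : 0 < dotr u u by lra.
set s := Num.sqrt (dotr u u).
have s0 : 0 < s by rewrite sqrtr_gt0.
have ss : dotr u u = s * s by rewrite -expr2 sqr_sqrtr ?ltW.
have e1 : dotr (s^-1 *: u) (s^-1 *: u) = 1.
  by rewrite !(dotrZl, dotrZr) ss; field; rewrite gt_eqF.
have := h (s^-1 *: u); rewrite e1 dotrZr ss mulKf ?gt_eqF// => /(_ (lexx _)) s1.
by rewrite ss in u1; nra.
Qed.

(** Equal lengths give 2 <u, d> = |d|^2, so the reflection along [d] subtracts exactly [d] from
    [u]. *)
Lemma dotr_colinear u v : dotr u u = dotr v v -> u != v ->
  let d := u - v in
  u - (2 * dotr u d / dotr d d) *: d = v.
Proof.
move=> uv /negP unv d; have d0 : dotr d d != 0.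
  by rewrite dotr_eq0 subr_eq0; apply/negP.
suff -> : 2 * dotr u d / dotr d d = 1 by rewrite scale1r /d opprB addrC subrK.
apply: (mulIf d0); rewrite mulfVK// mul1r /d !(dotrBl, dotrBr) uv (dotrC v u).
ring.
Qed.

End DotProduct.

(** * The scalar product attached to an invertible matrix *)

Section FormOfMatrix.
Context {R : realType} {n : nat}.
Local Notation V := 'rV[R]_n.
Implicit Types (A C : 'M[R]_n) (x y : V).

Definition mxdot A x y : R := dotr (x *m A) (y *m A).

Lemma scalar_product_mxdot A : A \in unitmx -> scalar_product (mxdot A).
Proof.
move=> uA.
have adl u : zmod_morphism (mxdot A ^~ u).
  by move=> x y; rewrite /mxdot mulmxBl dotrBl.
have adr u : zmod_morphism (mxdot A u).
  by move=> x y; rewrite /mxdot mulmxBl dotrBr.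
have scl u : scalable_for *%R (mxdot A ^~ u).
  by move=> a x; rewrite /mxdot -scalemxAl dotrZl.
have scr u : scalable_for (idfun \; *%R) (mxdot A u).
  by move=> a x; rewrite /mxdot -scalemxAl dotrZr.
have herm x y : mxdot A x y = (-1) ^+ false * idfun (mxdot A y x).
  by rewrite expr0 mul1r /mxdot dotrC.
have pos u : u != 0 -> 0 < mxdot A u u.
  move=> u0; rewrite lt_neqAle dotr_ge0 eq_sym dotr_eq0 andbT.
  by apply: contra u0 => /eqP h; rewrite -(mulmxK uA u) h mul0mx.
pose bil := isBilinear.Build R V V R *%R (idfun \; *%R) (mxdot A) adl adr scl scr.
pose her := isHermitianSesquilinear.Build R V false idfun (mxdot A) herm.
pose dot := isDotProduct.Build R V (mxdot A) pos.
pose f : {dot V for idfun} := HB.pack (mxdot A) bil her dot.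
by exists f.
Qed.

End FormOfMatrix.

(** * Ellipsoids: scalar product, gauge and polar in matrix terms *)

Section EllipsoidGeometry.
Context {R : realType} {n : nat}.
Local Notation V := 'rV[R]_n.
Implicit Types (A C : 'M[R]_n) (x y : V) (K : set V).

Definition ell A : set V := [set x *m A | x in euclidean_ball].

Lemma ellP A x : A \in unitmx -> ell A x <-> mxdot (invmx A) x x <= 1.
Proof.
move=> uA; split=> [[z]|h].
  by rewrite /euclidean_ball/= -dotr_sqr => zz <-; rewrite /mxdot mulmxK.
exists (x *m invmx A); last by rewrite mulmxKV.
by rewrite /euclidean_ball/= -dotr_sqr.
Qed.

Lemma mxdot_ge0 A x : 0 <= mxdot A x x.
Proof. exact: dotr_ge0. Qed.

Lemma mxdotZ A (a : R) x : mxdot A (a *: x) (a *: x) = a ^+ 2 * mxdot A x x.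
Proof. by rewrite /mxdot -scalemxAl dotrZl dotrZr mulrA -expr2. Qed.

Lemma mxdotD A x y :
  mxdot A (x + y) (x + y) = mxdot A x x + 2 * mxdot A x y + mxdot A y y.
Proof.
by rewrite /mxdot mulmxDl !(dotrDl, dotrDr) (dotrC (y *m A) (x *m A)); ring.
Qed.

(** If p < q, the scale with a^2 = 2 / (p + q) gives a^2 p < 1 < a^2 q. *)
Lemma eq_of_sqr_mul_le1 (p q : R) : 0 <= p -> 0 <= q ->
  (forall a : R, (a ^+ 2 * p <= 1) <-> (a ^+ 2 * q <= 1)) -> p = q.
Proof.
wlog : p q / p < q => [wlg p0 q0 h|pq p0 q0 h].
  case: (ltgtP p q) => // pq; first exact: wlg.
  by apply/esym; apply: wlg => // a; apply: iff_sym.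
have pq0 : 0 < p + q by lra.
have a2 : Num.sqrt (2 / (p + q)) ^+ 2 = 2 / (p + q).
  by rewrite sqr_sqrtr// divr_ge0// ltW.
have [+ _] := h (Num.sqrt (2 / (p + q))); rewrite a2 ![2 / _ * _]mulrAC.
rewrite !ler_pdivrMr// => h'; exfalso.
by suff : 2 * q <= 1 * (p + q); [lra|apply: h'; lra].
Qed.

(** The unit ball determines a form on the diagonal, by scaling along each line, and polarization
    recovers the rest. *)
Lemma dotE_ell A : A \in unitmx -> dotE (ell A) = mxdot (invmx A).
Proof.
move=> uA; have uA' : invmx A \in unitmx by rewrite unitmx_inv.
apply: get_unique => /=.
  split; first exact: scalar_product_mxdot.
  by apply/seteqP; split=> x /(ellP _ uA).
move=> B [[f ->] h].
have fxx x : f x x = mxdot (invmx A) x x.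
  apply: eq_of_sqr_mul_le1; [|exact: mxdot_ge0|move=> a].
    have [->|x0] := eqVneq x 0; first by rewrite linear0r.
    exact/ltW/neq0_dnorm_gt0.
  rewrite -mxdotZ; apply: iff_trans (ellP _ uA).
  have <- : f (a *: x) (a *: x) = a ^+ 2 * f x x.
    by rewrite (linearZl_LR f) (linearZr_LR f) expr2 -mulrA.
  by rewrite h.
have fC x y : f x y = f y x by rewrite hermitian_subproof expr0 mul1r.
apply/funext => x; apply/funext => y.
have fD : f (x + y) (x + y) = f x x + f x y + (f y x + f y y).
  by rewrite (linearDl f) !(linearDr f).
have := fxx (x + y); rewrite fD !fxx (fC y x).
rewrite mxdotD; lra.
Qed.

Lemma gauge_norm_ell A x : A \in unitmx ->
  gauge_norm (ell A) x ^+ 2 = mxdot (invmx A) x x.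
Proof.
move=> uA; set q := mxdot _ _ _.
have q0 : 0 <= q by exact: mxdot_ge0.
suff -> : gauge_norm (ell A) x = Num.sqrt q by rewrite sqr_sqrtr.
rewrite /gauge_norm; set S := [set _ | _].
have SE l : S l <-> 0 < l /\ Num.sqrt q <= l.
  suff h : 0 < l -> (([set l *: y | y in ell A] x) <-> Num.sqrt q <= l).
    by split=> -[l0 /(h l0)].
  move=> l0; have <- : (q <= l ^+ 2) = (Num.sqrt q <= l).
    by rewrite -{1}(sqr_sqrtr q0) ler_pXn2r// ?nnegrE ?sqrtr_ge0// ltW.
  split=> [[y /(ellP _ uA) yA xE]|ql].
    by rewrite /q -xE mxdotZ ler_piMr// sqr_ge0.
  exists (l^-1 *: x); last by rewrite scalerA divff ?gt_eqF// scale1r.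
  by apply/(ellP _ uA); rewrite mxdotZ exprVn mulrC ler_pdivrMr ?exprn_gt0// mul1r.
have S0 : S !=set0.
  by exists (Num.sqrt q + 1); apply/SE; rewrite ltr_wpDl ?sqrtr_ge0// lerDl.
apply/eqP; rewrite eq_le; apply/andP; split.
  apply/ler_addgt0Pr => e e0; apply: ge_inf; first by exists 0 => l /SE[/ltW].
  by apply/SE; rewrite ltr_wpDl ?sqrtr_ge0// lerDl ltW.
by apply: lb_le_inf => // l /SE[].
Qed.

Lemma sub_polarC (L K F : set V) : (forall x y, dotE F x y = dotE F y x) ->
  L `<=` polar K F -> K `<=` polar L F.
Proof. by move=> FC LK x Kx y Ly; rewrite FC; exact: LK. Qed.

(* The inverse of a matrix of the polar of [ell C] with respect to [ell A]. *)
Definition dual_mx A C := invmx A *m (invmx A)^T *m C^T.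

(** Moving the matrices across the product turns <x, z C>_F into the Euclidean product of x
    [dual_mx A C] with z, and the Euclidean ball is self-polar. *)
Lemma polar_ell A C : A \in unitmx -> C \in unitmx ->
  polar (ell C) (ell A) = ell (invmx (dual_mx A C)).
Proof.
move=> uA uC.
have uD : dual_mx A C \in unitmx.
  by rewrite /dual_mx !unitmx_mul !unitmx_tr !unitmx_inv uA uC.
apply/seteqP; split=> x.
  move=> h; apply/ellP; rewrite ?unitmx_inv// invmxK.
  apply/dotr_le1P => z zz; have /h : ell C (z *m C).
    by exists z => //; rewrite /euclidean_ball/= -dotr_sqr.
  by rewrite dotE_ell// /mxdot !dotr_adj /dual_mx !trmx_mul !trmxK !mulmxA.
move/(ellP _); rewrite unitmx_inv invmxK => /(_ uD)/dotr_le1P h y [z zz <-].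
rewrite dotE_ell// /mxdot.
have := h z; rewrite dotr_sqr => /(_ zz).
by rewrite !dotr_adj /dual_mx !trmx_mul !trmxK !mulmxA.
Qed.

Lemma ellipsoidE F : ellipsoid F -> exists2 A, A \in unitmx & F = ell A.
Proof. by case=> A uA ->; exists A. Qed.

Lemma ellipsoid_ell A : A \in unitmx -> ellipsoid (ell A).
Proof. by exists A. Qed.

Lemma eq_ell A C : A \in unitmx -> C \in unitmx ->
  invmx A *m (invmx A)^T = invmx C *m (invmx C)^T -> ell A = ell C.
Proof.
move=> uA uC h; apply/seteqP; split=> x /(ellP _ _) hx; apply/ellP => //.
  have := hx uA; rewrite /mxdot dotr_adj -mulmxA h.
  by rewrite [in X in _ -> X]dotr_adj -mulmxA.
have := hx uC; rewrite /mxdot dotr_adj -mulmxA -h.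
by rewrite [in X in _ -> X]dotr_adj -mulmxA.
Qed.

End EllipsoidGeometry.

(** * The trace functional and its variation along a segment of forms *)

Section TraceFunctional.
Context {R : realType} {n : nat}.
Context (S : 'M[R]_n).
Implicit Types (A C M P X : 'M[R]_n).

(** With [S] the second moment matrix of a measure, this is the integral of |x M|^2. *)
Definition trq M : R := \tr (S *m (M *m M^T)).

(** In the expanded square of C^-1 - D both cross terms equal A^-1 A^-T, whatever C is. *)
Lemma trq_dual_mx A C : A \in unitmx -> C \in unitmx ->
  trq (invmx C) + trq (dual_mx A C) =
  2 * trq (invmx A) + trq (invmx C - dual_mx A C).
Proof.
move=> uA uC; set X := invmx C; set D := dual_mx A C.
have XD : X *m D^T = invmx A *m (invmx A)^T.
  by rewrite /D /dual_mx !trmx_mul !trmxK mulKmx.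
have DX : D *m X^T = invmx A *m (invmx A)^T.
  by rewrite -[LHS]trmxK trmx_mul trmxK XD trmx_mul trmxK.
rewrite /trq linearB/= mulmxBl !mulmxBr XD DX.
rewrite !(mxtraceD, linearN)/=; ring.
Qed.

Lemma dotr_mulmx_tr M (u v : 'rV[R]_n) :
  dotr (u *m M) (v *m M) = dotr u (v *m (M *m M^T)).
Proof. by rewrite dotr_adj mulmxA. Qed.

(* In the coordinates of F, (1 - t) I + t M M^T = I + t P is the form of an
   ellipsoid containing K, but its inverse need not be available as a square
   X X^T without a spectral theorem. The square of N = I - (t/2) P agrees with
   this inverse up to O(t^2); the factor 1 - c t^2 absorbs the error. *)
Lemma interpolated_form_ge M (t : R) (w : 'rV[R]_n)
    (P := M *m M^T - 1%:M) (N := 1%:M - (t / 2) *: P) : 0 <= t -> t <= 1 ->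
  (1 - (\sum_j \sum_i P i j ^+ 2) * t ^+ 2) * dotr w w <=
  (1 - t) * dotr (w *m N) (w *m N) + t * dotr (w *m N *m M) (w *m N *m M).
Proof.
move=> t0 t1; set c := \sum_j _.
have MM : M *m M^T = 1%:M + P by rewrite /P addrC subrK.
have PT : P^T = P by rewrite /P linearB/= trmx_mul trmxK trmx1.
have wN (x : 'rV[R]_n) : x *m N = x - (t / 2) *: (x *m P).
  by rewrite /N mulmxBr mulmx1 -scalemxAr.
rewrite [X in _ + t * X]dotr_mulmx_tr MM mulmxDr mulmx1 dotrDr.
set u := w *m P; set y := dotr u (u *m P).
have wu : dotr w (u *m P) = dotr u u by rewrite -{1}PT -dotr_adj.
have wNP : w *m N *m P = u - (t / 2) *: (u *m P) by rewrite wN mulmxBl -scalemxAl.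
rewrite wNP wN -/u !(dotrBl, dotrBr, dotrZl, dotrZr) wu -/y (dotrC u w).
have dc : dotr u u <= c * dotr w w by exact: dotr_mulmx_le.
(* I + P = M M^T is positive semidefinite; this bounds the cubic term in t from below. *)
have yd : - dotr u u <= y.
  have := dotr_ge0 (u *m M); rewrite dotr_mulmx_tr MM mulmxDr mulmx1 dotrDr -/y; lra.
have d0 := dotr_ge0 u.
move: dc yd d0; set a := dotr w w; set b := dotr w u; set d := dotr u u.
move=> dc yd d0.
have h1 : t ^+ 2 * d <= t ^+ 2 * (c * a) by rewrite ler_wpM2l ?sqr_ge0.
have h2 : - (t ^+ 2 * (t * d)) <= t ^+ 2 * (t * y).
  by rewrite -!mulrN ler_wpM2l ?sqr_ge0// ler_wpM2l.
have h3 : t ^+ 2 * (t * d) <= t ^+ 2 * d by rewrite ler_wpM2l ?sqr_ge0// ler_piMl.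
rewrite [leRHS](_ : _ = a - t ^+ 2 * d * (3/4) + t ^+ 2 * (t * y) / 4); last by field.
lra.
Qed.

Lemma exists_small (c d e : R) : 0 <= c -> 0 < e ->
  exists t, [/\ 0 < t, t <= 1, c * t ^+ 2 < 1 & t * d < e].
Proof.
move=> c0 e0; set k := 2 + c + `|d| / e.
have de : 0 <= `|d| / e by rewrite divr_ge0// ltW.
have k0 : 0 < k by rewrite /k; lra.
have t1 : k^-1 <= 1 by rewrite invf_le1// /k; lra.
exists k^-1; split => //; first by rewrite invr_gt0.
  rewrite expr2 mulrA -ltr_pdivlMr ?invr_gt0// invrK mul1r ltr_pdivrMr//.
  by rewrite /k; nra.
apply: le_lt_trans (ler_wpM2l _ (ler_norm d)) _; first by rewrite invr_ge0 ltW.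
rewrite mulrC ltr_pdivrMr// /k !mulrDr mulrCA divff ?gt_eqF//.
by have := mulr_ge0 (ltW e0) c0; lra.
Qed.

Lemma unitmx_inj A : (forall w : 'rV[R]_n, w *m A = 0 -> w = 0) -> A \in unitmx.
Proof.
move=> h; rewrite -row_free_unit -kermx_eq0; apply/rowV0P => v /sub_kermxP.
exact: h.
Qed.

Lemma mulmx_sqr1B (a : R) X : (1%:M - a *: X) *m (1%:M - a *: X) =
  1%:M + (- (2 * a)) *: X + a ^+ 2 *: (X *m X).
Proof.
rewrite mulmxBl !mulmxBr !mul1mx mulmx1 -!scalemxAl -!scalemxAr.
by apply/matrixP => i j; rewrite !mxE; ring.
Qed.

(** Otherwise, for small t, the polar of an ellipsoid slightly larger than the one interpolated
    between [ell A] and [ell C] lies in the polar of [K] and has [trq] below that of [ell A]. *)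
Lemma trq_le_of_inscribed_min A C (K : set 'rV[R]_n) :
  A \in unitmx -> C \in unitmx -> K `<=` ell A -> K `<=` ell C ->
  (forall H, H \in unitmx -> ell H `<=` polar K (ell A) ->
    trq (invmx A) <= trq (invmx H)) ->
  trq (invmx C) <= trq (invmx A).
Proof.
move=> uA uC KA KC min.
(* In the coordinates y A^-1, [ell A] has form I and [ell C] has form M M^T, so [P] is the direction
   of the segment. The linear [h] evaluates the functional on forms written in these coordinates. *)
set M := A *m invmx C; set P := M *m M^T - 1%:M.
pose h X := \tr (S *m (invmx A *m X *m (invmx A)^T)).
have hD X Y : h (X + Y) = h X + h Y.
  by rewrite /h mulmxDr mulmxDl mulmxDr mxtraceD.
have hZ (a : R) X : h (a *: X) = a * h X.
  by rewrite /h -scalemxAr -scalemxAl -scalemxAr mxtraceZ.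
have h1 : h 1%:M = trq (invmx A) by rewrite /h mulmx1.
have hP : h P = trq (invmx C) - trq (invmx A).
  rewrite /P hD -scaleN1r hZ h1 mulN1r; congr (_ - _).
  rewrite /h /trq; congr (\tr (S *m _)).
  by rewrite /M trmx_mul -!mulmxA mulKmx// -trmx_mul mulVmx// trmx1 mulmx1.
rewrite -subr_ge0 -opprB oppr_ge0 -hP leNgt; apply/negP => hP0.
set c := \sum_j \sum_i P i j ^+ 2.
have c0 : 0 <= c by do 2![apply: sumr_ge0 => ? _]; rewrite sqr_ge0.
(* The bound [ct] keeps the scaling factor positive; [lt_hP] contradicts the inequality that
   minimality yields after division by t^2. *)
have [t [t0 t1 ct lt_hP]] := exists_small (h (P *m P) / 4 + c * h 1%:M) c0 hP0.
set N := 1%:M - (t / 2) *: P.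
have form w := interpolated_form_ge M w (ltW t0) t1.
rewrite /= -/P -/N -/c in form.
have s0 : 0 < 1 - c * t ^+ 2 by lra.
set s := Num.sqrt (1 - c * t ^+ 2).
have ss : s ^+ 2 = 1 - c * t ^+ 2 by rewrite sqr_sqrtr// ltW.
have s_gt0 : 0 < s by rewrite sqrtr_gt0.
have uN : N \in unitmx.
  apply: unitmx_inj => w wN; have := form w.
  rewrite wN mul0mx dotr0l !mulr0 addr0 pmulr_rle0// => ww.
  by apply/eqP; rewrite -dotr_eq0 eq_le ww dotr_ge0.
have NT : N^T = N.
  by rewrite /N /P !(linearB, linearZ)/= trmx_mul trmxK trmx1.
(* Chosen so that H^-1 = s^-1 A^-1 N, whose form in these coordinates is N^2 / (1 - c t^2). *)
pose H := s *: (invmx N *m A).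
have us : s \is a GRing.unit by rewrite unitfE gt_eqF.
have uH : H \in unitmx by rewrite unitmxZ// unitmx_mul unitmx_inv uN.
have HV : invmx H = s^-1 *: (invmx A *m N).
  apply: (can_inj (mulKmx uH)); rewrite mulmxV// /H -scalemxAl -scalemxAr.
  by rewrite scalerA divff ?gt_eqF// scale1r -!mulmxA mulKVmx// mulVmx.
have HK : ell H `<=` polar K (ell A).
  move=> x [z zz <-] y Ky; rewrite dotE_ell// /mxdot.
  set y' := y *m invmx A.
  rewrite /H -scalemxAr -scalemxAl mulmxA mulmxK// dotrZl dotr_adj trmx_inv NT.
  set w := y' *m invmx N.
  rewrite -dotrZr; move: z zz; rewrite /euclidean_ball/=.
  suff /dotr_le1P h' : dotr (s *: w) (s *: w) <= 1.
    by move=> z; rewrite -dotr_sqr dotrC => /h'.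
  (* The interpolated form at y is a convex combination of the two forms, both at most 1 on [K]. *)
  rewrite dotrZl dotrZr mulrA -expr2 ss; apply: le_trans (form w) _.
  rewrite /w mulmxKV// {2}/y' /M mulmxA mulmxKV//.
  have /(ellP _ uA) yA := KA _ Ky; have /(ellP _ uC) yC := KC _ Ky.
  have : (1 - t) * dotr y' y' <= 1 - t by rewrite ler_piMr//; lra.
  have : t * dotr (y *m invmx C) (y *m invmx C) <= t by rewrite ler_piMr// ltW.
  lra.
have := min _ uH HK.
have -> : trq (invmx H) = (1 - c * t ^+ 2)^-1 * h (N *m N).
  rewrite HV /trq /h linearZ/= -scalemxAl -!scalemxAr !mxtraceZ mulrA -invfM.
  by rewrite -expr2 ss trmx_mul NT !mulmxA.
have -> : N *m N = 1%:M + (- t) *: P + (t ^+ 2 / 4) *: (P *m P).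
  by rewrite /N mulmx_sqr1B; congr (_ + _ *: _ + _ *: _); field.
rewrite !hD !hZ -h1 mulrC ler_pdivlMr// => le1.
suff : t * h P <= t * (t * (h (P *m P) / 4 + c * h 1%:M)).
  by rewrite ler_pM2l// leNgt lt_hP.
lra.
Qed.

End TraceFunctional.

(** * Borel measurability and the boundary of an ellipsoid *)

Section BorelRowVectors.
Context {R : realType} {n : nat}.
Local Notation V := 'rV[R]_n.

Lemma open_measurable_rV (U : set (borel_rV R n)) :
  open (U : set V) -> measurable U.
Proof. by move=> oU; apply: sub_sigma_algebra. Qed.

Lemma closed_measurable_rV (U : set (borel_rV R n)) :
  closed (U : set V) -> measurable U.
Proof.
move=> cU; rewrite -[U]setCK; apply: measurableC.
by apply: open_measurable_rV; exact: closed_openC.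
Qed.

Lemma continuous_measurable_rV (f : V -> R) : continuous f ->
  measurable_fun setT (f : borel_rV R n -> R).
Proof.
move=> /continuousP cf.
apply: (measurability _ (measurable_realfun.RGenOpens.measurableE R)).
move=> _ [_ [a [b ->] <-]]; rewrite setTI.
by apply: open_measurable_rV; apply: cf; exact: interval_open.
Qed.

Lemma continuous_dotr (v : V) : continuous (fun x : V => dotr x v).
Proof.
move=> x; rewrite /continuous_at
  (_ : (fun x : V => _) = fun x : V => \sum_i x 0 i * v 0 i);
  last by apply/funext => y; rewrite dotrE.
rewrite dotrE; apply: (@cvg_big R _ _ _ _ _ V (nbhs x)) => [|i _].
  exact: add_continuous.
by apply: cvgM; [exact: coord_continuous|exact: cvg_cst].
Qed.

Lemma continuous_mulmx_coord (B : 'M[R]_n) j :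
  continuous (fun x : V => (x *m B) 0 j).
Proof.
rewrite (_ : (fun _ => _) = fun x : V => dotr x (delta_mx 0 j *m B^T)).
  exact: continuous_dotr.
by apply/funext => x; rewrite -dotr_adj dotr_delta.
Qed.

Lemma continuous_mxdot (B : 'M[R]_n) : continuous (fun x : V => mxdot B x x).
Proof.
move=> x; rewrite /continuous_at
  (_ : (fun x : V => _) = fun x : V => \sum_i (x *m B) 0 i * (x *m B) 0 i);
  last by apply/funext => y; rewrite /mxdot dotrE.
rewrite /mxdot dotrE; apply: (@cvg_big R _ _ _ _ _ V (nbhs x)) => [|i _].
  exact: add_continuous.
by apply: cvgM; exact: continuous_mulmx_coord.
Qed.

(** The ellipsoid is closed, giving <= 1, and the open set where the form is < 1 lies in its
    interior. *)
Lemma boundary_ell (A : 'M[R]_n) (x : V) : A \in unitmx ->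
  boundary (ell A) x -> mxdot (invmx A) x x = 1.
Proof.
move=> uA [clx intx].
have q_cont : continuous (fun x : V => mxdot (invmx A) x x).
  exact: continuous_mxdot.
have ellE : ell A = (fun x => mxdot (invmx A) x x) @^-1` [set r | r <= 1].
  by apply/seteqP; split=> y /(ellP _ uA).
apply/eqP; rewrite eq_le; apply/andP; split.
  suff /closure_id h : closed (ell A) by move: clx; rewrite -h => /(ellP _ uA).
  by rewrite ellE; apply: closed_comp => [y _|]; [exact: q_cont|exact: closed_le].
rewrite leNgt; apply/negP => x1; apply: intx.
have oq : open ((fun x => mxdot (invmx A) x x) @^-1` [set r | r < 1]).
  by apply: open_comp => [y _|]; [exact: q_cont|exact: open_lt].
rewrite /interior; apply: filterS (open_nbhs_nbhs (conj oq x1)) => y /ltW ?.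
exact/ellP.
Qed.

Lemma measurable_boundary (A : set V) :
  measurable (boundary A : set (borel_rV R n)).
Proof.
apply: measurableD.
  by apply: closed_measurable_rV; exact: closed_closure.
by apply: open_measurable_rV; exact: open_interior.
Qed.

End BorelRowVectors.

(** * Householder reflections *)

Section Reflection.
Context {R : realType} {n : nat}.
Local Notation V := 'rV[R]_n.
Implicit Types (d u v : V).

Definition reflmx d : 'M[R]_n := 1%:M - (2 / dotr d d) *: (d^T *m d).

Lemma mul_reflmx u d : u *m reflmx d = u - (2 * dotr u d / dotr d d) *: d.
Proof.
rewrite mulmxBr mulmx1 -scalemxAr mulmxA [u *m _]mx11_scalar mul_scalar_mx.
by rewrite scalerA -/(dotr u d) mulrAC.
Qed.

Lemma dotr_reflmx d u v : dotr (u *m reflmx d) v = dotr u (v *m reflmx d).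
Proof.
by rewrite !mul_reflmx !(dotrBl, dotrBr, dotrZl, dotrZr) (dotrC v d); ring.
Qed.

Lemma reflmxK d u : u *m reflmx d *m reflmx d = u.
Proof.
have [->|d0] := eqVneq d 0; first by rewrite !mul_reflmx !scaler0 !subr0.
have dd0 : dotr d d != 0 by rewrite dotr_eq0.
rewrite [in LHS]mul_reflmx !mul_reflmx dotrBl dotrZl -addrA -opprD -scalerDl.
rewrite [X in X *: _](_ : _ = 0) ?scale0r ?subr0//; by field.
Qed.

Lemma exists_reflmx u v : dotr u u = dotr v v ->
  u = v \/ exists d, u *m reflmx d = v.
Proof.
move=> uv; have [->|unv] := eqVneq u v; [by left|right].
by exists (u - v); rewrite mul_reflmx; exact: dotr_colinear.
Qed.

End Reflection.

(** * Second moments of the invariant measure *)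

Section SecondMoments.
Context {R : realType} {n : nat}.
Local Notation V := 'rV[R]_n.
Context (mu : probability (borel_rV R n) R) (A : 'M[R]_n).
Context (uA : A \in unitmx) (mu_inv : invariant_probability (ell A) mu).

Let B := invmx A.
Let bd : set (borel_rV R n) := boundary (ell A).
(** Complement of a hyperplane (for u nonzero) in the coordinates x A^-1; it is null when the
    hyperplane has full measure. *)
Let off u : set (borel_rV R n) := [set x | dotr (x *m B) u != 0].

Let measurable_bd : measurable bd.
Proof. exact: measurable_boundary. Qed.

Let mu_bd : mu bd = 1%E.
Proof. by case: mu_inv. Qed.

Let mu_bdC : mu (~` bd) = 0%E.
Proof. by rewrite probability_setC// mu_bd subee. Qed.

Let measurable_off u : measurable (off u).
Proof.
apply: open_measurable_rV.
have c : continuous (fun x : V => dotr (x *m B) u).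
  rewrite (_ : (fun _ => _) = fun x : V => dotr x (u *m B^T)).
    exact: continuous_dotr.
  by apply/funext => x; rewrite dotr_adj.
rewrite (_ : off u = (fun x : V => dotr (x *m B) u) @^-1` [set r | r != 0])//.
by apply: open_comp => [y _|]; [exact: c|exact: open_neq].
Qed.

(** Conjugating a Euclidean reflection by [A] gives an isometry of the ellipsoid, to which
    invariance applies. *)
Let off_reflmx u d : mu (off u) = 0%E -> mu (off (u *m reflmx d)) = 0%E.
Proof.
move=> <-; pose tau : {linear V -> V} := mulmxr (B *m reflmx d *m A).
have tauB x : tau x *m B = x *m B *m reflmx d.
  by rewrite /tau/= !mulmxA mulmxK.
have iso x y : dotE (ell A) (tau x) (tau y) = dotE (ell A) x y.
  by rewrite dotE_ell// /mxdot -/B !tauB dotr_reflmx reflmxK.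
rewrite -(mu_inv.2 tau iso _ (measurable_off u)).
by congr (mu _); apply/seteqP; split=> x; rewrite /off/= tauB dotr_reflmx.
Qed.

Let off_scale (a : R) u : a != 0 -> off (a *: u) = off u.
Proof.
by move=> a0; apply/seteqP; split=> x; rewrite /off/= dotrZr mulf_eq0 (negbTE a0).
Qed.

(** Rescaled to the length of [u], each basis vector is [u] or a reflection of it. If [off u] were
    null, so would be the sets [off] of all basis vectors, and these cover the boundary. *)
Lemma off_not_null u : u != 0 -> mu (off u) != 0%E.
Proof.
move=> u0; apply/eqP => null_u.
have uu : 0 < dotr u u by rewrite lt_neqAle eq_sym dotr_eq0 u0 dotr_ge0.
have null_e i : mu (off (delta_mx 0 i)) = 0%E.
  have s0 : Num.sqrt (dotr u u) != 0 by rewrite gt_eqF// sqrtr_gt0.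
  rewrite -(off_scale _ s0).
  have norm_e : dotr u u = dotr (Num.sqrt (dotr u u) *: delta_mx 0 i)
                                (Num.sqrt (dotr u u) *: delta_mx 0 i : V).
    rewrite dotrZl dotrZr mulrA -expr2 sqr_sqrtr ?ltW// dotr_delta mxE !eqxx.
    by rewrite mulr1.
  by have [<-//|[d <-]] := exists_reflmx norm_e; exact: off_reflmx.
have : mu.-negligible bd.
  apply: (@negligibleS _ _ _ _ (\big[setU/set0]_(i < n) off (delta_mx 0 i))).
    move=> x /(boundary_ell uA) x1.
    have /existsP[i xi] : [exists i, (x *m B) 0 i != 0].
      apply: contraT => /existsPn h; move: x1; rewrite /mxdot -/B.
      have -> : x *m B = 0; last first.
        by rewrite dotr0l => /esym/eqP; rewrite oner_eq0.
      by apply/rowP => i; rewrite [RHS]mxE; apply/eqP; have := h i; rewrite negbK.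
    by rewrite -bigcup_seq; exists i; rewrite /= ?mem_index_enum// /off/= dotr_delta.
  apply: big_ind => [|X Y|i _]; [exact: negligible_set0|exact: negligibleU|].
  by apply/(negligibleP _ (measurable_off _)); exact: null_e.
move=> bd_null; have /eqP : mu bd = 0%E by apply/(negligibleP _ measurable_bd).
by rewrite mu_bd onee_eq0.
Qed.

Let sqr_coord_le1 (x : V) i : boundary (ell A) x -> (x *m B) 0 i ^+ 2 <= 1.
Proof.
move=> /(boundary_ell uA) <-; rewrite /mxdot dotr_sqr (bigD1 i)//= lerDl.
by rewrite sumr_ge0// => j _; rewrite sqr_ge0.
Qed.

Let integrable_coordM i j : mu.-integrable bd
  (EFin \o (fun x : borel_rV R n => (x *m B) 0 i * (x *m B) 0 j)).
Proof.
have mu_fin : (mu bd < +oo)%E by rewrite mu_bd ltry.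
apply: measurable_bounded_integrable => //.
- apply: measurable_funTS; apply: measurable_realfun.measurable_funM;
    by apply: continuous_measurable_rV; exact: continuous_mulmx_coord.
- exists 1; split; first exact: num_real.
  move=> M M1 x bx /=; apply: le_trans (ltW M1).
  rewrite normrM -[leRHS]mul1r; apply: ler_pM => //;
    rewrite -(@ler_pXn2r _ 2)// ?nnegrE// expr1n real_normK ?num_real//;
    exact: sqr_coord_le1.
Qed.

Lemma Rintegral_sum (I : Type) (s : seq I) (f : I -> borel_rV R n -> R) :
  (forall i, mu.-integrable bd (EFin \o f i)) ->
  \int[mu]_(x in bd) (\sum_(i <- s) f i x) =
  \sum_(i <- s) \int[mu]_(x in bd) f i x.
Proof.
move=> fi; rewrite /Rintegral.
under eq_integral do rewrite -sumEFin.
rewrite integral_sum//.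
rewrite (eq_bigr (fun i => (fine (\int[mu]_(x in bd) (f i x)%:E)%E)%:E)).
  by rewrite sumEFin.
by move=> i _; rewrite fineK//; apply: integrable_fin_num => //; exact: fi.
Qed.

Let mxdot_coord M (x : V) : mxdot M x x =
  \sum_(p : 'I_n * 'I_n) (x *m B) 0 p.1 * (x *m B) 0 p.2
    * (A *m M *m (A *m M)^T) p.2 p.1.
Proof.
rewrite /mxdot -[in LHS](mulmxKV uA x) -!(mulmxA _ A M) dotr_mulmx_tr -/B.
set y := x *m B; set G := _ *m _^T.
rewrite dotrE; under eq_bigr do rewrite [X in _ * X]mxE mulr_sumr.
rewrite pair_big/=; apply: eq_bigr => -[i j] _ /=.
by rewrite mulrA.
Qed.

Let integrable_mxdot M :
  mu.-integrable bd (EFin \o (fun x : borel_rV R n => mxdot M x x)).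
Proof.
rewrite (_ : _ \o _ = fun x => (\sum_(p : 'I_n * 'I_n)
    ((x *m B) 0 p.1 * (x *m B) 0 p.2 * (A *m M *m (A *m M)^T) p.2 p.1)%:E)%E).
  apply: integrable_sum => // p _.
  exact: (integrableZr measurable_bd _ (integrable_coordM p.1 p.2)).
by apply/funext => x; rewrite /= mxdot_coord sumEFin.
Qed.

(** The nonnegative integrand vanishes almost everywhere, hence so does each coordinate of x M. The
    k-th one is the product of x A^-1 with column k of A M, so [off_not_null] kills that column. *)
Lemma mxdot_int0 M : \int[mu]_(x in bd) mxdot M x x = 0 -> M = 0.
Proof.
move=> int0.
have /(ae_eq_integral_abs mu measurable_bd) ae0 :
    (\int[mu]_(x in bd) `|(mxdot M x x)%:E|)%E = 0%E.
  under eq_integral do rewrite gee0_abs ?lee_fin ?mxdot_ge0//.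
  apply/eqP; rewrite -fine_eq0; first exact/eqP.
  exact: integrable_fin_num (integrable_mxdot M).
have {}ae0 : mu.-negligible (~` [set x | bd x -> (mxdot M x x)%:E = 0%E]).
  by apply: ae0; case/integrableP: (integrable_mxdot M).
have row_e k : delta_mx 0 k *m (A *m M)^T = 0 :> V.
  apply/eqP; apply: contraT => /off_not_null; apply: contraNT => _.
  apply/eqP/negligibleP => //; apply: negligibleS (negligibleU ae0 _).
  - move=> x xk; have [bx|nbx] := pselect (bd x); [left|right].
      move=> /(_ bx) [] x0; move: xk; rewrite /off/=.
      move/eqP: x0; rewrite /mxdot dotr_eq0 => /eqP x0.
      by rewrite -dotr_adj -mulmxA mulKmx// x0 dotr0l eqxx.
    exact: nbx.
  - by apply/negligibleP; [exact: measurableC|exact: mu_bdC].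
have : (A *m M)^T = 0 by apply/row_matrixP => k; rewrite rowE row_e row0.
move/(congr1 trmx); rewrite trmxK trmx0 => AM.
by rewrite -(mulKmx uA M) AM mulmx0.
Qed.

Lemma second_moment_matrix : exists S : 'M[R]_n,
  forall M, \int[mu]_(x in bd) mxdot M x x = trq S M.
Proof.
(* Moments are taken in the coordinates x A^-1, bounded by 1 on the boundary; conjugation by [A]
   returns to x. *)
pose S0 : 'M[R]_n :=
  \matrix_(i, j) \int[mu]_(x in bd) ((x *m B) 0 i * (x *m B) 0 j).
exists (A^T *m S0 *m A) => M.
rewrite /trq -!mulmxA mxtrace_mulC -!mulmxA -trmx_mul (mulmxA A M).
under eq_Rintegral do rewrite mxdot_coord.
rewrite Rintegral_sum => [|p]; last first.
  exact: (integrableZr measurable_bd _ (integrable_coordM p.1 p.2)).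
rewrite /mxtrace; under [RHS]eq_bigr do rewrite mxE.
rewrite pair_big/=; apply: eq_bigr => p _.
by rewrite (RintegralZr _ measurable_bd (integrable_coordM p.1 p.2)) [S0 _ _]mxE.
Qed.

(** This says that n > 0: in dimension 0 the boundary is empty and cannot carry mass 1. *)
Lemma unit_mx_neq0 : (1%:M : 'M[R]_n) != 0.
Proof.
apply/eqP => e0; have : bd = set0.
  apply/seteqP; split=> x // /(boundary_ell uA)/eqP.
  by rewrite /mxdot -[x]mulmx1 e0 mulmx0 mul0mx dotr0l eq_sym oner_eq0.
by move: mu_bd => /[swap] ->; rewrite measure0 => /eqP; rewrite eq_sym onee_eq0.
Qed.

End SecondMoments.

(** * Attained extrema and the equivalence *)

Lemma inf_min {R : realType} (X : set R) (m : R) :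
  X m -> lbound X m -> inf X = m.
Proof.
move=> Xm lb; apply/eqP; rewrite eq_le; apply/andP; split.
  by apply: ge_inf => //; exists m.
by apply: lb_le_inf => //; exists m.
Qed.

Lemma sup_max {R : realType} (X : set R) (m : R) :
  X m -> ubound X m -> sup X = m.
Proof.
move=> Xm ub; apply/eqP; rewrite eq_le; apply/andP; split.
  by apply: ge_sup => //; exists m.
by apply: ub_le_sup => //; exists m.
Qed.

Theorem proposition5p1 (R : realType) (n : nat) (K E F : set 'rV[R]_n)
    (mu : probability (borel_rV R n) R) :
  body K -> ellipsoid E -> ellipsoid F -> invariant_probability E mu ->
  (ubar mu K E F <-> u_ mu (polar K F) E = F).
Proof.
move=> _ /ellipsoidE[A0 uA0 ->] /ellipsoidE[A uA ->] mu_inv.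
have [S intS] := second_moment_matrix uA0 mu_inv.
have t_ge0 M : 0 <= trq S M.
  by rewrite -intS; apply: Rintegral_ge0 => x _; exact: mxdot_ge0.
have t_eq0 M : trq S M = 0 -> M = 0.
  by rewrite -intS; exact: (mxdot_int0 uA0 mu_inv).
have ME C : C \in unitmx -> M_ mu (ell A0) (ell C) = Num.sqrt (trq S (invmx C)).
  move=> uC; rewrite /M_ -intS; congr (Num.sqrt _).
  by apply: eq_Rintegral => x _; exact: gauge_norm_ell.
have M_le C D : C \in unitmx -> D \in unitmx ->
    (M_ mu (ell A0) (ell C) <= M_ mu (ell A0) (ell D)) =
    (trq S (invmx C) <= trq S (invmx D)).
  by move=> uC uD; rewrite !ME// ler_sqrt.
have dotC x y : dotE (ell A) x y = dotE (ell A) y x.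
  by rewrite dotE_ell// /mxdot dotrC.
have polarA : polar (ell A) (ell A) = ell A.
  rewrite polar_ell// /dual_mx -mulmxA -trmx_mul mulmxV// trmx1 mulmx1.
  by rewrite invmxK.
(* F is its own F-polar and polarity reverses inclusions. *)
have FK : ell A `<=` polar K (ell A) <-> K `<=` ell A.
  split=> h; first by rewrite -polarA; exact: sub_polarC h.
  by apply: (sub_polarC dotC); rewrite polarA.
have uD C : C \in unitmx -> dual_mx A C \in unitmx.
  by move=> uC; rewrite /dual_mx !unitmx_mul !unitmx_tr !unitmx_inv uA uC.
split=> [[_ KF supF]|uF].
- have max C : C \in unitmx -> K `<=` ell C -> trq S (invmx C) <= trq S (invmx A).
    move=> uC KC; rewrite -M_le// supF; apply: ub_le_sup; last first.
      by exists (ell C) => //; split => //; exact: ellipsoid_ell.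
    (* An unbounded family would give I_ the junk value sup = 0. *)
    apply: contrapT => unbounded; have := unit_mx_neq0 uA0 mu_inv.
    suff -> : 1%:M = 0 :> 'M[R]_n by rewrite eqxx.
    rewrite -(mulmxV uA) (t_eq0 (invmx A)) ?mulmx0//; apply/eqP.
    by rewrite eq_le t_ge0 andbT -sqrtr_eq0 -ME// supF /I_ sup_out ?eqxx// => -[].
  (* The F-polar of [ell C] contains [K], so it competes in the maximum. *)
  have dual_le C : C \in unitmx -> ell C `<=` polar K (ell A) ->
      trq S (dual_mx A C) <= trq S (invmx A).
    move=> uC /(sub_polarC dotC); rewrite polar_ell// => /max.
    by rewrite unitmx_inv invmxK; apply; exact: uD.
  have min C : C \in unitmx -> ell C `<=` polar K (ell A) ->
      trq S (invmx A) <= trq S (invmx C).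
    move=> uC /(dual_le _ uC); have := trq_dual_mx S uA uC.
    by have := t_ge0 (invmx C - dual_mx A C); lra.
  have JE : J_ mu (polar K (ell A)) (ell A0) = M_ mu (ell A0) (ell A).
    apply: inf_min.
      by exists (ell A) => //; split; [exact: ellipsoid_ell|exact/FK].
    by move=> _ [_ [/ellipsoidE[C uC ->] CK] <-]; rewrite M_le// min.
  apply: get_unique => /=.
    by split; [exact: ellipsoid_ell|exact/FK|rewrite JE].
  move=> _ [/ellipsoidE[C uC ->] CK]; rewrite JE => MC.
  have tC : trq S (invmx C) <= trq S (invmx A) by rewrite -M_le// MC.
  (* Equality in [trq_dual_mx] makes the square term vanish. Then C^-1 C^-T = D C^-T = A^-1 A^-T, so
     the ellipsoids agree. *)
  have CD : invmx C = dual_mx A C.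
    apply/eqP; rewrite -subr_eq0; apply/eqP/t_eq0.
    have := trq_dual_mx S uA uC; have := dual_le _ uC CK.
    by have := t_ge0 (invmx C - dual_mx A C); lra.
  apply: eq_ell => //; rewrite {2}CD /dual_mx !trmx_mul !trmxK.
  by rewrite mulKmx.
- have [_ FKpolar minF] : [/\ ellipsoid (ell A), ell A `<=` polar K (ell A) &
      M_ mu (ell A0) (ell A) = J_ mu (polar K (ell A)) (ell A0)].
    rewrite -{1 2 4}uF; apply: (@getPex _ [set G | [/\ ellipsoid G,
      G `<=` polar K (ell A) & M_ mu (ell A0) G = J_ mu (polar K (ell A)) (ell A0)]]).
    (* Without a minimizer [get] would return the empty set, whereas F contains 0. *)
    apply: contrapT => none.
    have A_0 : ell A 0.
      by apply/ellP => //; rewrite /mxdot mul0mx dotr0l.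
    have := A_0; rewrite -uF /u_ getPN// => G PG; apply: none; by exists G.
  have KF := FK.1 FKpolar; split=> //; first exact: ellipsoid_ell.
  apply/esym/sup_max; first by exists (ell A) => //; split=> //; exact: ellipsoid_ell.
  move=> _ [_ [/ellipsoidE[C uC ->] KC] <-]; rewrite M_le//.
  apply: (@trq_le_of_inscribed_min _ _ _ _ _ K) => // H uH HK.
  rewrite -M_le// minF; apply: ge_inf; last first.
    by exists (ell H) => //; split=> //; exact: ellipsoid_ell.
  by exists 0 => _ [G _ <-]; exact: sqrtr_ge0.
Qed.
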